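(* Assume (A.1)–(A.6), and assume moreover that the stochastic function values have bounded variance: $\mathbb{E}_{\xi_t}|f(x_t;\xi_t)-f(x_t)|^2\le\sigma_f^2$ for all $t$. Run the SG-SAV iteration with $r_0=\sqrt{f(x_0)+c}$ for $T\ge1$ steps, and suppose the learning rate $\eta>0$ satisfies $$C_1\sqrt\eta+C_2\eta+C_3\le0,$$ where, with $F(x_0):=\sqrt{f(x_0)+c}$, $$C_1=F(x_0)\sqrt{T\Big(\frac{\gamma^2}{8a^3}\sigma_f^2+\frac1{2a}\sigma_0^2\Big)},\qquad C_2=\frac{L_F\,F(x_0)^2}{2},\qquad C_3=\frac{\sigma_f}{2\sqrt a}-\frac{\sqrt a}{2}.$$ Then $\mathbb{E}[r_T]\ge\frac{\sqrt a}{2}>0$.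
   Context: Let $f:\mathbb{R}^d\to\mathbb{R}$ be continuously differentiable and let $c\ge0$ be a constant with $f^*:=\inf_{x}f(x)>-c$. Let $\xi_0,\xi_1,\dots$ be random variables (mini-batch samples). For each $x\in\mathbb{R}^d$ and sample $\xi$, let $f(x;\xi)\in\mathbb{R}$ be a stochastic function value and $G(x;\xi)\in\mathbb{R}^d$ a stochastic gradient. Write $G_t:=G(x_t;\xi_t)$ and $\tilde F_t:=\sqrt{f(x_t;\xi_t)+c}$. Given $x_0\in\mathbb{R}^d$, a scalar $r_0$ and a learning rate $\eta>0$, the SG-SAV iteration defines $(x_{t+1},r_{t+1})$ for $t\ge0$ as the solution of the (linear) system $$x_{t+1}=x_t-\eta\,\frac{r_{t+1}}{\tilde F_t}\,G_t,\qquad r_{t+1}=r_t+\frac{1}{2\tilde F_t}\langle G_t,\,x_{t+1}-x_t\rangle .$$ Assumptions: (A.1) the $\xi_t$ are mutually independent and independent of $x_t$; (A.2) $\mathbb{E}_{\xi_t}[G_t]=\nabla f(x_t)$ and $\mathbb{E}_{\xi_t}[f(x_t;\xi_t)]=f(x_t)$, where $\mathbb{E}_{\xi_t}$ is expectation over $\xi_t$ conditioned on $\xi_0,\dots,\xi_{t-1}$; (A.3) there is $\sigma_0$ with $\mathbb{E}_{\xi_t}\|G(x_t;\xi_t)-\nabla f(x_t)\|^2\le\sigma_0^2$ for all $t$; (A.4) there are constants $0<a\le B$ with $a\le f(x)+c\le B$ and $a\le f(x;\xi)+c\le B$ for all $x,\xi$; (A.5) there is $\gamma$ with $\|\nabla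 f(x)\|^2\le\gamma^2$ for all $x$; (A.6) $\nabla f$ is $L$-Lipschitz. Let $F(x):=\sqrt{f(x)+c}$, $F_*:=\sqrt{f^*+c}$, and $L_F:=\frac{1}{2F_*}\Big(L+\frac{\gamma^2}{2F_*^2}\Big)$ (a Lipschitz constant of $\nabla F$). *)

(* Defs.v *)
From HB Require Import structures.
From mathcomp Require Import all_boot all_order all_algebra.
From mathcomp Require Import all_classical all_reals all_analysis.

Set Implicit Arguments.
Unset Strict Implicit.
Unset Printing Implicit Defensive.

Import Order.TTheory GRing.Theory Num.Theory.
Import numFieldNormedType.Exports.
Local Open Scope classical_set_scope.
Local Open Scope ring_scope.

(** Vectors of R^d are row vectors 'rV[R]_d, with the Euclidean structure
    (the library's norm on matrices is the max norm, so we define the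
    Euclidean inner product and norm explicitly). *)
Definition dotv {R : realType} {d : nat} (u v : 'rV[R]_d) : R :=
  \sum_(i < d) u ord0 i * v ord0 i.

Definition sqnorm {R : realType} {d : nat} (u : 'rV[R]_d) : R := dotv u u.

Definition enorm {R : realType} {d : nat} (u : 'rV[R]_d) : R :=
  Num.sqrt (sqnorm u).

Definition gen_sigma {d d' : measure_display} {Om : measurableType d}
  {S : measurableType d'} {I : Type} (J : set I) (X : I -> Om -> S)
  : set (set Om) :=
  <<s \bigcup_(i in J) preimage_set_system setT (X i) measurable >>.

Definition mutually_independent {d d' : measure_display} {Om : measurableType d}
  {S : measurableType d'} {R : realType} (P : probability Om R)
  (X : nat -> Om -> S) : Prop :=
  forall (J : seq nat) (B : nat -> set S), uniq J ->
    (forall j, j \in J -> measurable (B j)) ->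
    P (\big[setI/setT]_(j <- J) (X j @^-1` B j)) =
    (\prod_(j <- J) P (X j @^-1` B j))%E.

Definition indep_sets {d : measure_display} {Om : measurableType d}
  {R : realType} (P : probability Om R) (F1 F2 : set (set Om)) : Prop :=
  forall A B, F1 A -> F2 B -> P (A `&` B) = (P A * P B)%E.

Definition past {d d' : measure_display} {Om : measurableType d}
  {S : measurableType d'} (xi : nat -> Om -> S) (t : nat) : set (set Om) :=
  gen_sigma [set i | (i < t)%N] xi.

Definition coords {R : realType} {Om : Type} {d : nat}
  (x : Om -> 'rV[R]_d) : 'I_d -> Om -> R := fun i w => x w ord0 i.

(* Main.v *)
(** Writing [D t = x_(t+1) - x_t] and [e t = G_t / (2 F~_t) - grad F (x_t)], the
    recursion for [r] and the descent inequality for [F = sqrt (f + c)] give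
    [r_(t+1) - F x_(t+1) >= r_t - F x_t + <e t, D t> - L_F / 2 * |D t|^2].
    The energy law [r_(t+1)^2 + |D t|^2 / eta <= r_t^2] bounds the sum of the
    [|D t|^2] by [eta * F(x_0)^2], and [<e t, D t>] is split by Young's inequality
    with a parameter [k]. Taking expectations only requires the unconditional
    second moments of [e t], and optimising over [k] produces the term
    [C_1 * sqrt eta]. *)
Require Import Defs.
From HB Require Import structures.
From mathcomp Require Import all_boot all_order all_algebra.
From mathcomp Require Import all_classical all_reals all_analysis.
From mathcomp Require Import measurable_realfun ring lra.

Import Order.TTheory GRing.Theory Num.Theory.
Import numFieldNormedType.Exports.
Local Open Scope classical_set_scope.
Local Open Scope ring_scope.

(** * Euclidean geometry: Cauchy-Schwarz, Young, continuity of the norm *)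

Section euclidean_space.
Context {R : realType} {d : nat}.
Implicit Types (u v w : 'rV[R]_d) (k : R).

Lemma dotvC u v : dotv u v = dotv v u.
Proof. by apply: eq_bigr => i _; rewrite mulrC. Qed.

Lemma dotvDl u v w : dotv (u + v) w = dotv u w + dotv v w.
Proof. by rewrite -big_split; apply: eq_bigr => i _; rewrite mxE mulrDl. Qed.

Lemma dotvZl k u v : dotv (k *: u) v = k * dotv u v.
Proof. by rewrite mulr_sumr; apply: eq_bigr => i _; rewrite mxE mulrA. Qed.

Lemma dotvDr u v w : dotv u (v + w) = dotv u v + dotv u w.
Proof. by rewrite !(dotvC u) dotvDl. Qed.

Lemma dotvZr k u v : dotv u (k *: v) = k * dotv u v.
Proof. by rewrite !(dotvC u) dotvZl. Qed.

Lemma dotvBl u v w : dotv (u - v) w = dotv u w - dotv v w.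
Proof. by rewrite dotvDl -scaleN1r dotvZl mulN1r. Qed.

Lemma sqnorm_ge0 u : 0 <= sqnorm u.
Proof. by apply: sumr_ge0 => i _; rewrite -expr2 sqr_ge0. Qed.

Lemma sqnormD u v : sqnorm (u + v) = sqnorm u + 2 * dotv u v + sqnorm v.
Proof. by rewrite /sqnorm dotvDl !dotvDr (dotvC v u); ring. Qed.

Lemma sqnormZ k u : sqnorm (k *: u) = k ^+ 2 * sqnorm u.
Proof. by rewrite /sqnorm dotvZl dotvZr; ring. Qed.

Lemma enorm_ge0 u : 0 <= enorm u.
Proof. exact: sqrtr_ge0. Qed.

Lemma sqr_enorm u : enorm u ^+ 2 = sqnorm u.
Proof. by rewrite sqr_sqrtr ?sqnorm_ge0. Qed.

(** The squared norm of |v|^2 u - <u,v> v is nonnegative and equals |v|^2 (|u|^2 |v|^2 - <u,v>^2).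
    Dividing by |v|^2 leaves v = 0 as a separate case. *)
Lemma sqr_dotv_le u v : dotv u v ^+ 2 <= sqnorm u * sqnorm v.
Proof.
have [v0|v0] := eqVneq (sqnorm v) 0.
  suff -> : dotv u v = 0 by rewrite expr0n mulr_ge0 ?sqnorm_ge0.
  apply: big1 => i _; have /eqP := v0; rewrite psumr_eq0.
    by move/allP => /(_ i (mem_index_enum i)); rewrite mulf_eq0 orbb => /eqP->;
      rewrite mulr0.
  by move=> j _; rewrite -expr2 sqr_ge0.
have v_gt0 : 0 < sqnorm v by rewrite lt_def v0 sqnorm_ge0.
have := sqnorm_ge0 (sqnorm v *: u + (- dotv u v) *: v).
rewrite sqnormD !sqnormZ dotvZl dotvZr => h.
have : 0 <= sqnorm v * (sqnorm u * sqnorm v - dotv u v ^+ 2).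
  by apply: le_trans h _; rewrite le_eqVlt; apply/orP; left; apply/eqP; ring.
by rewrite pmulr_rge0 // subr_ge0.
Qed.

Lemma norm_dotv_le u v : `|dotv u v| <= enorm u * enorm v.
Proof.
rewrite -sqrtr_sqr -sqrtrM ?sqnorm_ge0 // ler_sqrt ?sqr_dotv_le //.
by rewrite mulr_ge0 ?sqnorm_ge0.
Qed.

(** Expand |k u + v|^2 >= 0 and divide by 2 k. *)
Lemma dotv_young (k : R) u v :
  0 < k -> - (k / 2 * sqnorm u + sqnorm v / (2 * k)) <= dotv u v.
Proof.
move=> k_gt0; have := sqnorm_ge0 (k *: u + v).
rewrite sqnormD sqnormZ dotvZl => h.
have : 0 <= (k ^+ 2 * sqnorm u + 2 * (k * dotv u v) + sqnorm v) / (2 * k).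
  by rewrite divr_ge0 // mulr_ge0 // ltW.
suff -> : (k ^+ 2 * sqnorm u + 2 * (k * dotv u v) + sqnorm v) / (2 * k) =
  k / 2 * sqnorm u + sqnorm v / (2 * k) + dotv u v by move=> ?; lra.
by field; rewrite lt0r_neq0.
Qed.

Lemma enorm_cvg0 u : enorm (v - u) @[v --> u] --> 0.
Proof.
(* The limit 0 is rewritten as the formula evaluated at [v = u], so that continuity of the root, the
   sum and the coordinates can be composed. *)
have -> : 0 = Num.sqrt (\sum_(i < d) (u ord0 i - u ord0 i) ^+ 2).
  by rewrite big1 ?sqrtr0 // => i _; rewrite subrr expr0n.
apply: (@continuous_cvg _ R R (nbhs u) (nbhs_filter u) (fun v => sqnorm (v - u)) Num.sqrt).
  exact: sqrt_continuous.
apply: (@cvg_big R _ +%R 0 _ add_continuous _ (nbhs u)) => i _.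
have cvg_i : (v - u) ord0 i @[v --> u] --> u ord0 i - u ord0 i.
  under eq_cvg do rewrite !mxE.
  apply: (@cvgB _ _ _ (nbhs u) (nbhs_filter u)); last exact: cvg_cst.
  exact: coord_continuous.
exact: (@cvgM _ _ (nbhs u) (nbhs_filter u)).
Qed.

End euclidean_space.

(** * Calculus of f and of sqrt (f + c) along segments *)

Section smooth_function.
Context {R : realType} {d : nat}.
Variables (f : 'rV[R]_d -> R) (gradf : 'rV[R]_d -> 'rV[R]_d).
Hypothesis f_diff : forall u v, is_derive u v f (dotv (gradf u) v).

(** Differentiability is given direction by direction, so f is studied through its restrictions to
    lines, where the one-variable mean value theorem applies. *)
Lemma is_derive_segment u v (s : R) :
  is_derive s 1 (fun s => f (u + s *: v)) (dotv (gradf (u + s *: v)) v).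
Proof.
have [df <-] := f_diff (u + s *: v) v.
have E : (fun h : R => h^-1 *: (((fun s => f (u + s *: v)) \o shift s) (h *: 1) -
    f (u + s *: v))) =
  (fun h => h^-1 *: ((f \o shift (u + s *: v)) (h *: v) - f (u + s *: v))).
  apply/funext => h /=; congr (_ *: (f _ - _)).
  by rewrite [h *: 1]mulr1 scalerDl addrCA.
by split; rewrite /derivable /derive E.
Qed.

Variable gamma : R.
Hypothesis gamma_ge0 : 0 <= gamma.
Hypothesis gradf_le : forall u, sqnorm (gradf u) <= gamma ^+ 2.

Lemma dotv_grad_le u v : `|dotv (gradf u) v| <= gamma * enorm v.
Proof.
apply: le_trans (norm_dotv_le _ _) _; rewrite ler_wpM2r ?enorm_ge0 //.
by rewrite -[gamma]ger0_norm // -sqrtr_sqr ler_sqrt ?sqr_ge0.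
Qed.

Lemma dist_segment_le u v (s : R) : 0 <= s ->
  `|f (u + s *: v) - f u| <= gamma * enorm v * s.
Proof.
rewrite le_eqVlt => /predU1P[<-|s_gt0].
  by rewrite scale0r addr0 subrr normr0 mulr0.
have [z _] := @MVT R _ _ 0 s s_gt0 (fun z _ => is_derive_segment u v z)
  (derivable_within_continuous (fun z _ => @ex_derive _ _ _ _ _ _ _ (is_derive_segment u v z))).
rewrite scale0r addr0 subr0 => ->.
by rewrite normrM (gtr0_norm s_gt0) ler_wpM2r ?dotv_grad_le // ltW.
Qed.

(** Directional derivatives alone do not give continuity; the gradient bound does, by making f
    Lipschitz along every segment. This later yields measurability of f(x_t). *)
Lemma bounded_grad_continuous : continuous f.
Proof.
move=> u.
have enorm_cvg : gamma * enorm (y - u) @[y --> u] --> 0.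
  by rewrite -[0](mulr0 gamma); apply: (@cvgMl_tmp _ _ (nbhs u) (nbhs_filter u));
    exact: enorm_cvg0.
apply/(@cvgrPdist_le _ _ _ (nbhs u) (nbhs_filter u)) => e e_gt0; near=> y.
rewrite distrC; have := dist_segment_le u (y - u) 1 ler01.
rewrite scale1r subrKC mulr1 => /le_trans; apply.
by near: y; exact: (@cvgr_le _ _ (nbhs u) (nbhs_filter u) _ _ enorm_cvg).
Unshelve. all: by end_near. Qed.

Variables (L c Fs : R).
Hypothesis gradf_lip : forall u v, enorm (gradf u - gradf v) <= L * enorm (u - v).
Hypothesis Fs_gt0 : 0 < Fs.
Hypothesis Fs_le : forall u, Fs <= Num.sqrt (f u + c).

Let F u := Num.sqrt (f u + c).
Let LF := 1 / (2 * Fs) * (L + gamma ^+ 2 / (2 * Fs ^+ 2)).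

Let F_gt0 u : 0 < F u.
Proof. exact: lt_le_trans Fs_gt0 (Fs_le u). Qed.

Let fc_gt0 u : 0 < f u + c.
Proof. by rewrite -sqrtr_gt0 F_gt0. Qed.

(** The difference of the roots times their sum is the difference of the values of f, and the sum of
    the roots is at least [2 * Fs]. *)
Lemma dist_sqrt_segment_le u v (s : R) : 0 <= s ->
  `|F (u + s *: v) - F u| <= gamma / (2 * Fs) * enorm v * s.
Proof.
move=> s_ge0.
have sum_gt0 : 0 < F (u + s *: v) + F u by rewrite addr_gt0.
have : `|F (u + s *: v) - F u| * (F (u + s *: v) + F u) <= gamma * enorm v * s.
  rewrite -[X in _ * X]gtr0_norm // -normrM -subr_sqr !sqr_sqrtr ?(ltW (fc_gt0 _)) //.
  by rewrite (_ : _ - _ = f (u + s *: v) - f u) ?dist_segment_le //; ring.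
have h : 2 * Fs <= F (u + s *: v) + F u.
  by rewrite mulrDl !mul1r lerD ?Fs_le.
move/(le_trans (ler_wpM2l (normr_ge0 _) h)).
by rewrite -ler_pdivlMr ?mulr_gt0 // => /le_trans; apply; rewrite le_eqVlt;
  apply/orP; left; apply/eqP; field; rewrite lt0r_neq0.
Qed.

Lemma grad_sqrt_lip u v (s : R) : 0 <= s ->
  dotv (gradf (u + s *: v)) v / (2 * F (u + s *: v)) -
    dotv (gradf u) v / (2 * F u) <= LF * sqnorm v * s.
Proof.
move=> s_ge0; set us := u + s *: v.
have Fus := F_gt0 us; have Fu := F_gt0 u.
(* First the numerator changes, then the denominator. The two pieces are controlled by [gradf_lip]
   and [dist_sqrt_segment_le], and match the two summands of [LF]. *)
have -> : dotv (gradf us) v / (2 * F us) - dotv (gradf u) v / (2 * F u) =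
   dotv (gradf us - gradf u) v / (2 * F us) +
   dotv (gradf u) v * (F u - F us) / (2 * F us * F u).
  by rewrite dotvBl; field; rewrite !lt0r_neq0.
have -> : LF * sqnorm v * s = L * (s * enorm v) * enorm v / (2 * Fs) +
   (gamma * enorm v) * (gamma / (2 * Fs) * enorm v * s) / (2 * Fs * Fs).
  by rewrite /LF -sqr_enorm; field; rewrite lt0r_neq0.
have ler_div (p q p' q' : R) : `|p| <= p' -> 0 < q' <= q -> p / q <= p' / q'.
  move=> pp' /andP[q'_gt0 q'q]; apply: le_trans (_ : `|p| / q <= _).
    by rewrite ler_wpM2r ?ler_norm // invr_ge0 ltW ?(lt_le_trans q'_gt0).
  by rewrite ler_pM ?invr_ge0 ?lef_pV2 ?posrE ?(lt_le_trans q'_gt0) //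
    ltW ?(lt_le_trans q'_gt0).
apply: lerD; apply: ler_div.
- apply: le_trans (norm_dotv_le _ _) _; rewrite ler_wpM2r ?enorm_ge0 //.
  apply: le_trans (gradf_lip _ _) _.
  by rewrite addrC addKr /enorm sqnormZ sqrtrM ?sqr_ge0 // sqrtr_sqr ger0_norm.
- by rewrite mulr_gt0 // ler_pM2l // Fs_le.
- rewrite normrM ler_pM ?dotv_grad_le // distrC.
  exact: dist_sqrt_segment_le.
- rewrite !mulr_gt0 //= ler_pM ?mulr_ge0 ?(ltW Fs_gt0) ?Fs_le //.
  by rewrite ler_pM2l // Fs_le.
Qed.

Lemma sqrt_descent u v :
  F (u + v) <= F u + dotv (gradf u) v / (2 * F u) + LF / 2 * sqnorm v.
Proof.
pose D w := dotv (gradf w) v / (2 * F w).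
(* [psi] is F on the segment minus its tangent and the quadratic remainder. By [grad_sqrt_lip] its
   derivative is at most 0 for s >= 0, so psi(1) <= psi(0), which is the claim. *)
pose psi (s : R) := F (u + s *: v) - D u * s - LF / 2 * sqnorm v * s ^+ 2.
have psi_der (s : R) :
    is_derive s 1 psi (D (u + s *: v) - D u - LF * sqnorm v * s).
  have dseg := is_derive_segment u v s.
  have dsqrt := @is_derive1_sqrt R (f (u + s *: v) + c) (fc_gt0 _).
  have dF : is_derive s 1 (fun s => F (u + s *: v)) (D (u + s *: v)).
    have dfc : is_derive s 1 (fun s => f (u + s *: v) + c)
        (dotv (gradf (u + s *: v)) v).
      by apply: is_derive_eq; rewrite addr0.
    have := @is_derive1_comp R Num.sqrt (fun s => f (u + s *: v) + c) s _ _ dsqrt dfc.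
    by rewrite mulrC.
  rewrite /psi; apply: is_derive_eq.
  by rewrite /GRing.scale /=; field.
have [z] := @MVT R _ _ 0 1 ltr01 (fun z _ => psi_der z)
  (derivable_within_continuous (fun z _ => @ex_derive _ _ _ _ _ _ _ (psi_der z))).
rewrite in_itv /= => /andP[z_gt0 _]; rewrite subr0 mulr1 => psi01.
have := grad_sqrt_lip u v z (ltW z_gt0); rewrite -/(D u) -/(D (u + z *: v)).
move: psi01; rewrite /psi scale1r scale0r addr0 expr0n expr1n => /= psi01 h.
lra.
Qed.

End smooth_function.

(** * Single-step estimates and the optimisation over the Young parameter *)

(** The displacement is a multiple of [G], so the implicit system collapses to a scalar equation
    that can be solved for [r']. The gap in the energy inequality is exactly eta (r - r')^2. *)
Lemma sav_step {R : realType} {d : nat} (eta r r' F2 : R) (G x x' : 'rV[R]_d) :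
  0 < eta -> 0 < F2 -> 0 <= r ->
  x' = x - (eta * r' / Num.sqrt F2) *: G ->
  r' = r + 1 / (2 * Num.sqrt F2) * dotv G (x' - x) ->
  r' = r / (1 + eta / 2 * sqnorm G / F2) /\
  sqnorm (x' - x) <= eta * (r ^+ 2 - r' ^+ 2).
Proof.
move=> eta_gt0 F2_gt0 r_ge0 xE; set F := Num.sqrt F2 in xE *.
have F_gt0 : 0 < F by rewrite sqrtr_gt0.
have F2E : F2 = F ^+ 2 by rewrite sqr_sqrtr // ltW.
have -> : x' - x = (- (eta * r' / F)) *: G by rewrite xE addrC addKr scaleNr.
rewrite dotvZr sqnormZ -/(sqnorm G) => rE.
have den_gt0 : 0 < 1 + eta / 2 * sqnorm G / F2.
  by rewrite ltr_pwDl // !mulr_ge0 ?invr_ge0 ?sqnorm_ge0 // ltW.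
have rr' : r = r' * (1 + eta / 2 * sqnorm G / F2).
  rewrite -(addrK (1 / (2 * F) * (- (eta * r' / F) * sqnorm G)) r) -rE F2E.
  by field; rewrite lt0r_neq0.
split; first by rewrite {1}rr' mulfK // lt0r_neq0.
rewrite rr' F2E -subr_ge0.
have -> : eta * ((r' * (1 + eta / 2 * sqnorm G / F ^+ 2)) ^+ 2 - r' ^+ 2) -
    (- (eta * r' / F)) ^+ 2 * sqnorm G =
  eta * (r' * (eta / 2 * sqnorm G / F ^+ 2)) ^+ 2.
  by field; rewrite lt0r_neq0.
by rewrite mulr_ge0 ?sqr_ge0 // ltW.
Qed.

(** The error splits into (G - g) / (2 sqrt p) plus a multiple of g due to replacing sqrt q by sqrt
    p. Rationalising the difference of roots brings out p - q, and (sqrt p + sqrt q)^2 >= 4 a gives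
    the constant 8 a^3. *)
Lemma sqnorm_sqrt_error_le {R : realType} {d : nat} (a gamma p q : R)
    (G g : 'rV[R]_d) :
  0 < a -> a <= p -> a <= q -> sqnorm g <= gamma ^+ 2 ->
  sqnorm ((1 / (2 * Num.sqrt p)) *: G - (1 / (2 * Num.sqrt q)) *: g) <=
  1 / (2 * a) * sqnorm (G - g) + gamma ^+ 2 / (8 * a ^+ 3) * (p - q) ^+ 2.
Proof.
move=> a_gt0 ap aq g_le.
have p_gt0 := lt_le_trans a_gt0 ap; have q_gt0 := lt_le_trans a_gt0 aq.
have sqr2D (u v : 'rV[R]_d) : sqnorm (u + v) <= 2 * sqnorm u + 2 * sqnorm v.
  have := sqnorm_ge0 (u + (-1) *: v).
  by rewrite !sqnormD sqnormZ dotvZr; lra.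
set P := Num.sqrt p; set Q := Num.sqrt q.
have P_gt0 : 0 < P by rewrite sqrtr_gt0.
have Q_gt0 : 0 < Q by rewrite sqrtr_gt0.
have PQ_gt0 : 0 < P + Q by rewrite addr_gt0.
have pE : P ^+ 2 = p by rewrite sqr_sqrtr // ltW.
have qE : Q ^+ 2 = q by rewrite sqr_sqrtr // ltW.
have -> : (1 / (2 * P)) *: G - (1 / (2 * Q)) *: g =
    (1 / (2 * P)) *: (G - g) + ((Q - P) / (2 * P * Q)) *: g.
  rewrite scalerBr -addrA -!(scaleNr _ g) -scalerDl; congr (_ + _ *: _).
  by field; rewrite !lt0r_neq0.
apply: le_trans (sqr2D _ _) _; rewrite !sqnormZ; apply: lerD.
  rewrite mulrA ler_wpM2r ?sqnorm_ge0 //.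
  have -> : 2 * (1 / (2 * P)) ^+ 2 = 1 / (2 * p).
    by rewrite -pE; field; rewrite lt0r_neq0.
  by rewrite ler_pM2l // lef_pV2 ?posrE ?mulr_gt0 // ler_pM2l.
have -> : 2 * (((Q - P) / (2 * P * Q)) ^+ 2 * sqnorm g) =
    (p - q) ^+ 2 * (sqnorm g / (2 * (P + Q) ^+ 2 * p * q)).
  rewrite -pE -qE; field.
  by rewrite !lt0r_neq0.
rewrite [leRHS]mulrC ler_wpM2l ?sqr_ge0 //.
have PQ_ge : 4 * a <= (P + Q) ^+ 2.
  have PQ : a <= P * Q.
    rewrite -[a]gtr0_norm // -sqrtr_sqr /P /Q -sqrtrM ?(ltW p_gt0) //.
    by rewrite ler_sqrt ?mulr_ge0 ?expr2 ?ler_pM // ltW.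
  by rewrite sqrrD pE qE; lra.
have den : 8 * a ^+ 3 <= 2 * (P + Q) ^+ 2 * p * q.
  have -> : 8 * a ^+ 3 = 2 * (4 * a) * a * a by ring.
  move: ((P + Q) ^+ 2) PQ_ge => S PQ_ge.
  by rewrite !ler_pM ?mulr_ge0 ?ler0n ?(ltW a_gt0).
rewrite ler_pM ?sqnorm_ge0 ?invr_ge0 ?mulr_ge0 ?sqr_ge0 ?(ltW p_gt0) ?(ltW q_gt0) ?(ltW PQ_gt0) //.
by rewrite lef_pV2 ?posrE ?mulr_gt0 ?exprn_gt0.
Qed.

(* The infimum over [k] of the right-hand side is attained at [q / sqrt K] for
   [0 < K] and approached as [k] tends to infinity for [K = 0]. *)
Lemma young_optimum {R : realType} (X q K m : R) : 0 < q -> 0 <= K ->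
  (forall k, 0 < k -> X <= m + k / 2 * K + q ^+ 2 / (2 * k)) ->
  X - q * Num.sqrt K <= m.
Proof.
move=> q_gt0; rewrite le_eqVlt => /predU1P[<-|K_gt0] mX.
  rewrite sqrtr0 mulr0 subr0 leNgt; apply/negP => m_lt.
  have Xm : 0 < X - m by rewrite subr_gt0.
  have := mX (q ^+ 2 / (X - m)) (divr_gt0 (exprn_gt0 _ q_gt0) Xm).
  have -> : q ^+ 2 / (2 * (q ^+ 2 / (X - m))) = (X - m) / 2.
    by field; rewrite !lt0r_neq0.
  by lra.
set s := Num.sqrt K; have s_gt0 : 0 < s by rewrite sqrtr_gt0.
have := mX (q / s) (divr_gt0 q_gt0 s_gt0).
have -> : K = s ^+ 2 by rewrite sqr_sqrtr // ltW.
have -> : q / s / 2 * s ^+ 2 = q * s / 2 by field; rewrite lt0r_neq0.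
have -> : q ^+ 2 / (2 * (q / s)) = q * s / 2 by field; rewrite !lt0r_neq0.
by lra.
Qed.

(** * Measurability of continuous functions of a random vector *)

Lemma measurable_continuous_rV {R : realType} {n : nat} (d0 : measure_display)
    (Om : measurableType d0) (x : Om -> 'rV[R]_n) (g : 'rV[R]_n -> R) :
  (forall i, measurable_fun setT (fun w => x w ord0 i)) -> continuous g ->
  measurable_fun setT (g \o x).
Proof.
move=> mx /continuousP g_cont.
apply: (measurability _ (RGenOpens.measurableE R)) => _ [_ [a [b ->] <-]].
rewrite setTI comp_preimage; set U := g @^-1` _.
have U_open : open U by apply: g_cont; exact: interval_open.
(* The open set [U] is a countable union of balls with rational centre and radius 1/(k+1); pairs
   whose ball leaves [U] contribute the empty set. Balls of the max norm are products of intervals,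
   hence measurable from the coordinates. *)
pose q_ (p : 'rV[rat]_n * nat) : 'rV[R]_n := map_mx ratr p.1.
pose box (p : 'rV[rat]_n * nat) : set 'rV[R]_n :=
  if `[< ball (q_ p) (p.2.+1%:R^-1) `<=` U >] then ball (q_ p) (p.2.+1%:R^-1)
  else set0.
have -> : x @^-1` U = \bigcup_p (x @^-1` box p).
  apply/seteqP; split => w /=; last first.
    by move=> [p _]; rewrite /box; case: asboolP => // sub /sub.
  move=> Uxw; have /nbhs_ballP[e /= e_gt0 eU] := open_nbhs_nbhs (conj U_open Uxw).
  (* Half of [e]: a ball of this radius around a centre this close to [x w] stays within distance
     [e] of [x w]. *)
  have [k ke] : exists k : nat, k.+1%:R^-1 < e / 2.
    have [k _ /(_ k (leqnn k))] := near_infty_natSinv_lt (PosNum (divr_gt0 e_gt0 (ltr0n R 2))).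
    by exists k.
  have k_gt0 : 0 < k.+1%:R^-1 :> R by rewrite invr_gt0.
  have qP (i : 'I_n) : exists q : rat, `|x w ord0 i - ratr q| < k.+1%:R^-1.
    move: (k.+1%:R^-1) k_gt0 => e' e'_gt0.
    have lohi : x w ord0 i - e' < x w ord0 i + e' by lra.
    have [q] := rat_in_itvoo lohi.
    by rewrite in_itv /= => /andP[lo hi]; exists q; rewrite ltr_norml; apply/andP; lra.
  pose q : 'rV[rat]_n := \row_i projT1 (cid (qP i)).
  have qx : ball (q_ (q, k)) k.+1%:R^-1 (x w).
    split=> // i j; rewrite (ord1 i) /q_ !mxE /ball /= distrC.
    exact: projT2 (cid (qP j)).
  exists (q, k) => //=; rewrite /box asboolT // => y qy.
  apply: eU; rewrite [e]splitr; apply: ball_triangle (_ : ball _ _ (q_ (q, k))) _.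
    by apply/ball_sym; apply: le_ball qx; exact: ltW.
  by apply: le_ball qy; exact: ltW.
apply: countable_bigcupT_measurable => [|p]; first exact: countableP.
rewrite /box; case: ifP => _; last by rewrite preimage_set0.
have -> : x @^-1` ball (q_ p) p.2.+1%:R^-1 =
    \bigcap_(i in [set: 'I_n]) ((fun w => x w ord0 i) @^-1` ball (q_ p ord0 i) p.2.+1%:R^-1).
  apply/seteqP; split => w /=; first by move=> [_ h] i _; exact: h.
  by move=> h; split=> [|i j]; [rewrite invr_gt0 | rewrite (ord1 i); exact: h].
apply: fin_bigcap_measurable => // i _.
by rewrite -[X in measurable X]setTI; apply: mx => //; exact: measurable_ball.
Qed.

(** * Summation along one trajectory *)

Lemma sav_path_bound {R : realType} {d : nat} (f : 'rV[R]_d -> R)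
    (gradf : 'rV[R]_d -> 'rV[R]_d) (gamma L c Fs eta k : R)
    (x g : nat -> 'rV[R]_d) (p r : nat -> R) (t : nat) :
  let F u := Num.sqrt (f u + c) in
  let LF := 1 / (2 * Fs) * (L + gamma ^+ 2 / (2 * Fs ^+ 2)) in
  (forall u v, is_derive u v f (dotv (gradf u) v)) ->
  0 <= gamma -> (forall u, sqnorm (gradf u) <= gamma ^+ 2) ->
  0 <= L -> (forall u v, enorm (gradf u - gradf v) <= L * enorm (u - v)) ->
  0 < Fs -> (forall u, Fs <= F u) ->
  0 < eta -> 0 < k -> (forall i, 0 < p i) -> r 0%N = F (x 0%N) ->
  (forall i, 0 <= r i) ->
  (forall i, x i.+1 = x i - (eta * r i.+1 / Num.sqrt (p i)) *: g i) ->
  (forall i, r i.+1 = r i + 1 / (2 * Num.sqrt (p i)) * dotv (g i) (x i.+1 - x i)) ->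
  F (x t) <= r t +
    k / 2 * \sum_(i < t) sqnorm ((1 / (2 * Num.sqrt (p i))) *: g i -
                                 (1 / (2 * F (x i))) *: gradf (x i)) +
    (LF / 2 + 1 / (2 * k)) * (eta * r 0%N ^+ 2).
Proof.
move=> F LF f_diff gamma_ge0 gradf_le L_ge0 gradf_lip Fs_gt0 Fs_le eta_gt0 k_gt0.
move=> p_gt0 r0E r_ge0 xE rE.
have coef_ge0 : 0 <= LF / 2 + 1 / (2 * k).
  have LF_ge0 : 0 <= LF.
    by rewrite /LF mulr_ge0 ?addr_ge0 ?divr_ge0 ?mulr_ge0 ?sqr_ge0 ?(ltW Fs_gt0).
  by rewrite addr_ge0 // divr_ge0 // mulr_ge0 // ltW.
pose e i := (1 / (2 * Num.sqrt (p i))) *: g i - (1 / (2 * F (x i))) *: gradf (x i).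
(* Keeping the term - r_t^2 makes the energy decrements telescope in the induction; it is dropped
   only at the end. *)
suff : F (x t) <= r t + k / 2 * \sum_(i < t) sqnorm (e i) +
    (LF / 2 + 1 / (2 * k)) * (eta * (r 0%N ^+ 2 - r t ^+ 2)).
  move=> /le_trans; apply; rewrite lerD2l ler_wpM2l // ler_pM2l //.
  by rewrite gerBl sqr_ge0.
elim: t => [|t IH]; first by rewrite big_ord0 r0E subrr !mulr0 !addr0.
rewrite big_ord_recr /=.
set S := \sum_(i < t) _ in IH *.
set D := x t.+1 - x t.
have [_ DE] := sav_step _ _ _ _ _ _ _ eta_gt0 (p_gt0 t) (r_ge0 t) (xE t) (rE t).
have := sqrt_descent _ _ f_diff gamma gamma_ge0 gradf_le L c Fs gradf_lip
  Fs_gt0 Fs_le (x t) D.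
rewrite -/(F _) -/(F _) -/LF subrKC.
have := dotv_young k (e t) D k_gt0.
(* The recursion for r identifies the stochastic part of <e_t, D> with r_(t+1) - r_t. *)
have -> : dotv (e t) D = r t.+1 - r t - dotv (gradf (x t)) D / (2 * F (x t)).
  by rewrite /e dotvBl !dotvZl (rE t) -/D -/(F _) !mul1r [_^-1 * dotv (gradf _) _]mulrC; ring.
move: (dotv (gradf (x t)) D / _) => z young desc.
have := ler_wpM2l coef_ge0 DE; rewrite -/D => step.
have -> : k / 2 * (S + sqnorm (e t)) = k / 2 * S + k / 2 * sqnorm (e t) by rewrite mulrDr.
have split_coef y : (LF / 2 + 1 / (2 * k)) * y = LF / 2 * y + y / (2 * k).
  by rewrite mulrDl mul1r [_^-1 * y]mulrC.
have step_rest : (LF / 2 + 1 / (2 * k)) * (eta * (r 0%N ^+ 2 - r t.+1 ^+ 2)) =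
    (LF / 2 + 1 / (2 * k)) * (eta * (r 0%N ^+ 2 - r t ^+ 2)) +
    (LF / 2 + 1 / (2 * k)) * (eta * (r t ^+ 2 - r t.+1 ^+ 2)) by ring.
rewrite step_rest; move: step; rewrite (split_coef (sqnorm D)).
move: IH young desc.
move: (_ * (eta * (r 0%N ^+ 2 - r t ^+ 2))) (_ * (eta * (r t ^+ 2 - _))) => y1 y2.
move: (k / 2 * S) (k / 2 * sqnorm (e t)) (sqnorm D / (2 * k)) (LF / 2 * sqnorm D) => *.
lra.
Qed.

(** * Passage to expectations *)

Lemma expectation_path_lower_bound {R : realType} (d0 : measure_display)
    (Om : measurableType d0) (P : probability Om R) (Y : Om -> R)
    (N M : nat -> Om -> R) (T : nat) (X k al be v1 v2 : R) :
  measurable_fun setT Y -> (forall t, measurable_fun setT (N t)) ->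
  (forall t, measurable_fun setT (M t)) ->
  (forall w, 0 <= Y w) -> (forall t w, 0 <= N t w) -> (forall t w, 0 <= M t w) ->
  0 <= k -> 0 <= al -> 0 <= be ->
  (forall t, (\int[P]_w (N t w)%:E <= v1%:E)%E) ->
  (forall t, (\int[P]_w (M t w)%:E <= v2%:E)%E) ->
  (forall w, X <= Y w + k * \sum_(i < T) (al * N i w + be * M i w)) ->
  (X%:E <= \int[P]_w (Y w)%:E + (k * (T%:R * (al * v1 + be * v2)))%:E)%E.
Proof.
move=> mY mN mM Y_ge0 N_ge0 M_ge0 k_ge0 al_ge0 be_ge0 Nle Mle XY.
pose V i w := al * N i w + be * M i w.
have mV i : measurable_fun setT (V i).
  by apply: measurable_funD; apply: measurable_funM => //; exact: measurable_cst.
have V_ge0 i w : 0 <= V i w by rewrite addr_ge0 ?mulr_ge0.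
have sumV_ge0 w : 0 <= \sum_(i < T) V i w by apply: sumr_ge0.
have msumV : measurable_fun setT (fun w => \sum_(i < T) V i w).
  exact: measurable_sum.
have intV i : (\int[P]_w (V i w)%:E <= (al * v1 + be * v2)%:E)%E.
  under eq_integral do rewrite EFinD !EFinM.
  have mNE : measurable_fun setT (EFin \o N i) by exact/measurable_EFinP.
  have mME : measurable_fun setT (EFin \o M i) by exact/measurable_EFinP.
  rewrite ge0_integralD //; first last.
  - by apply/measurable_EFinP; apply: measurable_funM.
  - by move=> w _; rewrite -EFinM lee_fin mulr_ge0.
  - by apply/measurable_EFinP; apply: measurable_funM.
  - by move=> w _; rewrite -EFinM lee_fin mulr_ge0.
  rewrite !ge0_integralZl_EFin // => [|w _|w _]; rewrite ?lee_fin //.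
  by rewrite EFinD !EFinM leeD // lee_wpmul2l ?lee_fin.
(* Monotonicity is applied to nonnegative integrands, so a nonpositive constant is treated apart;
   there the right-hand side is already nonnegative. *)
have [X_le0|/ltW X_ge0] := leP X 0.
  have v_ge0 : 0 <= al * v1 + be * v2.
    rewrite -lee_fin; apply: le_trans (intV 0%N).
    by apply: integral_ge0 => w _; rewrite lee_fin.
  apply: le_trans (_ : (0 <= _)%E); first by rewrite lee_fin.
  rewrite adde_ge0 ?lee_fin ?mulr_ge0 //.
  by apply: integral_ge0 => w _; rewrite lee_fin.
have -> : X%:E = (\int[P]_w X%:E)%E.
  by rewrite integral_cst // [X in (_ * X)%E]probability_setT mule1.
apply: le_trans (_ : (_ <= \int[P]_w ((Y w)%:E + k%:E * (\sum_(i < T) V i w)%:E))%E) _.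
  apply: ge0_le_integral => //.
  - by apply/measurable_EFinP; apply: measurable_funD => //; apply: measurable_funM.
  - by move=> w _; rewrite -EFinM -EFinD lee_fin.
rewrite ge0_integralD //; first last.
- by apply/measurable_EFinP; apply: measurable_funM.
- by move=> w _; rewrite -EFinM lee_fin mulr_ge0.
- exact/measurable_EFinP.
- by move=> w _; rewrite lee_fin.
rewrite leeD2l // ge0_integralZl_EFin //; last 2 first.
- by move=> w _; rewrite lee_fin.
- exact/measurable_EFinP.
rewrite EFinM lee_wpmul2l ?lee_fin //.
under eq_integral do rewrite -sumEFin.
rewrite ge0_integral_sum // => [|i|i w _]; last 2 first.
- exact/measurable_EFinP.
- by rewrite lee_fin.
apply: le_trans (lee_sum _ (fun (i : 'I_T) _ => intV i)) _.
by rewrite sumEFin sumr_const card_ord mulr_natl.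
Qed.

(** * Assembly: positivity, measurability, averaging and the learning-rate condition *)

Theorem theorem4p3
  (R : realType) (d : nat)
  (* the objective f : R^d -> R, its gradient, and the constant c *)
  (f : 'rV[R]_d -> R) (gradf : 'rV[R]_d -> 'rV[R]_d) (c : R)
  (* probability space and the mini-batch samples xi_t *)
  (d0 d1 : measure_display) (Om : measurableType d0) (P : probability Om R)
  (Xi : measurableType d1) (xi : nat -> Om -> Xi)
  (* stochastic function values f(x;xi) and stochastic gradients G(x;xi) *)
  (fs : 'rV[R]_d -> Xi -> R) (G : 'rV[R]_d -> Xi -> 'rV[R]_d)
  (* constants *)
  (a B sigma0 sigmaf gamma L eta : R) (x0 : 'rV[R]_d) (T : nat)
  (* the SG-SAV iterates *)
  (x : nat -> Om -> 'rV[R]_d) (r : nat -> Om -> R) :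
  (* f is continuously differentiable with gradient gradf *)
  (forall u v : 'rV[R]_d, is_derive u v f (dotv (gradf u) v)) ->
  continuous gradf ->
  0 <= c ->
  - c < inf (range f) ->
  (* the SG-SAV iteration with r_0 = sqrt(f(x_0)+c) *)
  (forall w, x 0%N w = x0) ->
  (forall w, r 0%N w = Num.sqrt (f x0 + c)) ->
  (forall t w,
     x t.+1 w = x t w - (eta * r t.+1 w / Num.sqrt (fs (x t w) (xi t w) + c))
                          *: G (x t w) (xi t w)) ->
  (forall t w,
     r t.+1 w = r t w + 1 / (2 * Num.sqrt (fs (x t w) (xi t w) + c))
                          * dotv (G (x t w) (xi t w)) (x t.+1 w - x t w)) ->
  (* measurability: xi_t, x_t, G_t and f(x_t;xi_t) are random variables *)
  (forall t, measurable_fun setT (xi t)) ->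
  (forall t i, measurable_fun setT (coords (x t) i)) ->
  (forall t i, measurable_fun setT (fun w => G (x t w) (xi t w) ord0 i)) ->
  (forall t, measurable_fun setT (fun w => fs (x t w) (xi t w))) ->
  (* (A.1) the xi_t are mutually independent and xi_t is independent of x_t *)
  mutually_independent P xi ->
  (forall t, indep_sets P (gen_sigma setT (coords (x t)))
                          (preimage_set_system setT (xi t) measurable)) ->
  (* (A.2) unbiasedness, conditionally on xi_0, ..., xi_{t-1}:
     E_{xi_t}[G_t] = grad f(x_t) and E_{xi_t}[f(x_t;xi_t)] = f(x_t) *)
  (forall t i, P.-integrable setT (fun w => (G (x t w) (xi t w) ord0 i)%:E)) ->
  (forall t i A, past xi t A ->
     (\int[P]_(w in A) (G (x t w) (xi t w) ord0 i)%:E =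
      \int[P]_(w in A) (gradf (x t w) ord0 i)%:E)%E) ->
  (forall t, P.-integrable setT (fun w => (fs (x t w) (xi t w))%:E)) ->
  (forall t A, past xi t A ->
     (\int[P]_(w in A) (fs (x t w) (xi t w))%:E =
      \int[P]_(w in A) (f (x t w))%:E)%E) ->
  (* (A.3) bounded variance of the stochastic gradients:
     E_{xi_t} ||G_t - grad f(x_t)||^2 <= sigma0^2 *)
  0 <= sigma0 ->
  (forall t A, past xi t A ->
     (\int[P]_(w in A) (sqnorm (G (x t w) (xi t w) - gradf (x t w)))%:E
        <= (sigma0 ^+ 2)%:E * P A)%E) ->
  (* bounded variance of the stochastic function values:
     E_{xi_t} |f(x_t;xi_t) - f(x_t)|^2 <= sigmaf^2 *)
  0 <= sigmaf ->
  (forall t A, past xi t A ->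
     (\int[P]_(w in A) ((fs (x t w) (xi t w) - f (x t w)) ^+ 2)%:E
        <= (sigmaf ^+ 2)%:E * P A)%E) ->
  (* (A.4) *)
  0 < a -> a <= B ->
  (forall u, a <= f u + c /\ f u + c <= B) ->
  (forall u s, a <= fs u s + c /\ fs u s + c <= B) ->
  (* (A.5) *)
  0 <= gamma ->
  (forall u, sqnorm (gradf u) <= gamma ^+ 2) ->
  (* (A.6) *)
  0 <= L ->
  (forall u v, enorm (gradf u - gradf v) <= L * enorm (u - v)) ->
  (* step count and learning-rate condition *)
  (1 <= T)%N ->
  0 < eta ->
  (let Fx0 := Num.sqrt (f x0 + c) in
   let Fstar := Num.sqrt (inf (range f) + c) in
   let LF := 1 / (2 * Fstar) * (L + gamma ^+ 2 / (2 * Fstar ^+ 2)) in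
   let C1 := Fx0 * Num.sqrt (T%:R * (gamma ^+ 2 / (8 * a ^+ 3) * sigmaf ^+ 2
                                     + 1 / (2 * a) * sigma0 ^+ 2)) in
   let C2 := LF * Fx0 ^+ 2 / 2 in
   let C3 := sigmaf / (2 * Num.sqrt a) - Num.sqrt a / 2 in
   C1 * Num.sqrt eta + C2 * eta + C3 <= 0) ->
  ((Num.sqrt a / 2)%:E <= 'E_P[r T])%E /\ 0 < Num.sqrt a / 2.
Proof.
move=> f_diff gradf_cont c_ge0 c_inf x0E r0E xE rE mxi mx mG mfs _ _ _ _ _ _.
move=> sigma0_ge0 G_var sigmaf_ge0 fs_var a_gt0 aB f_bnd fs_bnd gamma_ge0 gradf_le.
move=> L_ge0 gradf_lip T_ge1 eta_gt0 /=.
set Fx0 := Num.sqrt (f x0 + c); set Fstar := Num.sqrt (inf (range f) + c).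
set LF := 1 / (2 * Fstar) * _ => rate.
have sa_gt0 : 0 < Num.sqrt a by rewrite sqrtr_gt0.
split; last by rewrite divr_gt0.
have p_gt0 t w : 0 < fs (x t w) (xi t w) + c.
  exact: lt_le_trans a_gt0 (fs_bnd _ _).1.
have Fstar_gt0 : 0 < Fstar by rewrite sqrtr_gt0 -ltrBlDr sub0r.
have Fstar_le u : Fstar <= Num.sqrt (f u + c).
  rewrite ler_sqrt ?(le_trans (ltW a_gt0) (f_bnd u).1) // lerD2r.
  apply: ge_inf; last by exists u.
  by exists (a - c) => _ [v _ <-]; rewrite lerBlDr (f_bnd v).1.
have Fx0_gt0 : 0 < Fx0 by apply: lt_le_trans Fstar_gt0 (Fstar_le x0).
(* Each step divides r by this positive factor. The explicit form gives both nonnegativity and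
   measurability of r by induction, which the implicit recursion does not show. *)
pose den t w := 1 + eta / 2 * sqnorm (G (x t w) (xi t w)) / (fs (x t w) (xi t w) + c).
have den_gt0 t w : 0 < den t w.
  by rewrite ltr_pwDl // !mulr_ge0 ?invr_ge0 ?sqnorm_ge0 // ltW.
have r_step t w : 0 <= r t w -> r t.+1 w = r t w / den t w.
  by move=> r_ge0; have [] := sav_step _ _ _ _ _ _ _ eta_gt0 (p_gt0 t w) r_ge0 (xE t w) (rE t w).
have r_ge0 t w : 0 <= r t w.
  elim: t => [|t IH]; first by rewrite r0E sqrtr_ge0.
  by rewrite r_step // divr_ge0 // ltW.
have m_sqnorm (u : Om -> 'rV[R]_d) :
    (forall i, measurable_fun setT (fun w => u w ord0 i)) ->
    measurable_fun setT (fun w => sqnorm (u w)).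
  by move=> mu; apply: measurable_sum => i; apply: measurable_funM.
have m_inv (q : Om -> R) : (forall w, 0 < q w) -> measurable_fun setT q ->
    measurable_fun setT (fun w => (q w)^-1).
  move=> q_gt0 mq; rewrite (_ : (fun w => _) = fun w => q w `^ (-1)); last first.
    by apply/funext => w; rewrite powR_inv1 // ltW.
  exact: measurableT_comp (measurable_powR _) mq.
have mr t : measurable_fun setT (r t).
  elim: t => [|t IH].
    by rewrite (_ : r 0%N = cst Fx0) //; apply/funext => w; rewrite r0E.
  rewrite (_ : r t.+1 = fun w => r t w / den t w); last first.
    by apply/funext => w; rewrite r_step.
  apply: measurable_funM => //; apply: (m_inv) => //.
  apply: measurable_funD => //; apply: measurable_funM.
    by apply: measurable_funM => //; exact: m_sqnorm.
  by apply: (m_inv) => //; exact: measurable_funD.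
have f_cont := bounded_grad_continuous _ _ f_diff _ gamma_ge0 gradf_le.
have mf t : measurable_fun setT (fun w => f (x t w)).
  by apply: (measurable_continuous_rV _ _ (x t) f) => // i; exact: mx.
have mgradf t i : measurable_fun setT (fun w => gradf (x t w) ord0 i).
  apply: (measurable_continuous_rV _ _ (x t) (fun u => gradf u ord0 i)) => [j|u].
    exact: mx.
  apply: (@continuous_comp _ _ _ gradf (fun v => v ord0 i)).
    exact: gradf_cont.
  exact: coord_continuous.
pose N t w := sqnorm (G (x t w) (xi t w) - gradf (x t w)).
pose M t w := (fs (x t w) (xi t w) - f (x t w)) ^+ 2.
have mN t : measurable_fun setT (N t).
  apply: m_sqnorm => i; rewrite (_ : (fun w => _) =
    fun w => G (x t w) (xi t w) ord0 i - gradf (x t w) ord0 i).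
    exact: measurable_funB.
  by apply/funext => w; rewrite !mxE.
have mM t : measurable_fun setT (M t).
  by apply: measurable_funX; exact: measurable_funB.
(* On the whole space the conditional variance bounds become unconditional second-moment bounds. *)
have pastT t : past xi t setT.
  by rewrite -[setT]setD0; apply: sigma_algebraCD; exact: sigma_algebra0.
pose al := 1 / (2 * a); pose be := gamma ^+ 2 / (8 * a ^+ 3).
have al_ge0 : 0 <= al by rewrite divr_ge0 // mulr_ge0 // ltW.
have be_ge0 : 0 <= be by rewrite divr_ge0 ?sqr_ge0 // mulr_ge0 // exprn_ge0 // ltW.
have path_bound k w : 0 < k ->
    Num.sqrt a - LF / 2 * (eta * Fx0 ^+ 2) - eta * Fx0 ^+ 2 / (2 * k) <=
    r T w + k / 2 * \sum_(i < T) (al * N i w + be * M i w).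
  move=> k_gt0.
  have := @sav_path_bound R d f gradf gamma L c Fstar eta k
    (x ^~ w) (fun t => G (x t w) (xi t w)) (fun t => fs (x t w) (xi t w) + c)
    (r ^~ w) T f_diff gamma_ge0 gradf_le L_ge0 gradf_lip Fstar_gt0 Fstar_le
    eta_gt0 k_gt0 (p_gt0 ^~ w).
  rewrite -/LF /= r0E x0E => /(_ erefl (r_ge0 ^~ w) (xE ^~ w) (rE ^~ w)).
  rewrite -/Fx0; set S := \sum_(i < T) _ => path.
  have S_le : S <= \sum_(i < T) (al * N i w + be * M i w).
    apply: ler_sum => i _.
    have := @sqnorm_sqrt_error_le R d a gamma _ _ (G (x i w) (xi i w)) (gradf (x i w))
      a_gt0 (fs_bnd (x i w) (xi i w)).1 (f_bnd (x i w)).1 (gradf_le _).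
    by rewrite (_ : _ + c - (_ + c) = fs (x i w) (xi i w) - f (x i w)) //; ring.
  (* The lower bound f + c >= a at the last iterate is the source of the leading sqrt a. *)
  have sa_le : Num.sqrt a <= Num.sqrt (f (x T w) + c).
    by rewrite ler_sqrt ?(f_bnd _).1 // (le_trans (ltW a_gt0) (f_bnd _).1).
  move: path; rewrite [(_ + _) * (eta * _)]mulrDl mul1r [_^-1 * (eta * _)]mulrC => path.
  have := ler_wpM2l (ltW (divr_gt0 k_gt0 (ltr0n R 2))) S_le.
  lra.
have K_ge0 : 0 <= T%:R * (be * sigmaf ^+ 2 + al * sigma0 ^+ 2).
  by rewrite mulr_ge0 // addr_ge0 // mulr_ge0 ?sqr_ge0.
have mean_bound k : 0 < k ->
    ((Num.sqrt a - LF / 2 * (eta * Fx0 ^+ 2) - eta * Fx0 ^+ 2 / (2 * k))%:E <=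
    \int[P]_w (r T w)%:E +
      (k / 2 * (T%:R * (al * sigma0 ^+ 2 + be * sigmaf ^+ 2)))%:E)%E.
  move=> k_gt0; apply: (@expectation_path_lower_bound R _ _ P (r T) N M) => //.
  - by move=> t w; exact: sqnorm_ge0.
  - by move=> t w; exact: sqr_ge0.
  - by rewrite divr_ge0 // ltW.
  - by move=> t; rewrite -[leRHS]mule1 -(@probability_setT _ _ _ P); exact: G_var.
  - by move=> t; rewrite -[leRHS]mule1 -(@probability_setT _ _ _ P); exact: fs_var.
  - by move=> w; exact: path_bound.
rewrite unlock.
have : (0 <= \int[P]_w (r T w)%:E)%E by apply: integral_ge0 => w _; rewrite lee_fin.
(* Nonnegativity excludes the value -oo, and +oo satisfies the bound trivially. *)
move: mean_bound; case: (\int[P]_w (r T w)%:E)%E => [m||] mean_bound // m_ge0.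
  rewrite lee_fin.
  (* With q = F(x_0) sqrt eta, q^2 is the energy budget eta F(x_0)^2, and q sqrt K in
     [young_optimum] is C_1 sqrt eta. *)
  have q_gt0 : 0 < Fx0 * Num.sqrt eta by rewrite mulr_gt0 // sqrtr_gt0.
  have opt := @young_optimum R (Num.sqrt a - LF / 2 * (eta * Fx0 ^+ 2)) _ _ m q_gt0 K_ge0.
  apply: le_trans (opt _) => [|k k_gt0].
    (* As C_3 >= - sqrt a / 2, the rate condition gives C_1 sqrt eta + C_2 eta <= sqrt a / 2, so
       half of sqrt a survives. *)
    have C3_le : - (Num.sqrt a / 2) <= sigmaf / (2 * Num.sqrt a) - Num.sqrt a / 2.
      by rewrite lerDr divr_ge0 // mulr_ge0 // ltW.
    move: rate C3_le; rewrite -/al -/be.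
    have -> : LF * Fx0 ^+ 2 / 2 * eta = LF / 2 * (eta * Fx0 ^+ 2) by ring.
    rewrite [Fx0 * Num.sqrt eta * _]mulrAC; lra.
  have := mean_bound k k_gt0; rewrite -EFinD lee_fin.
  rewrite exprMn (sqr_sqrtr (ltW eta_gt0)) [be * _ + _]addrC [_ * eta]mulrC; lra.
by rewrite leey.
Qed.
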